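(* As formal power series in $q$, \[\sum_{\pi\in\mathcal{D}} (-1)^{\mathcal{E}(\pi)} q^{\mathcal{O}(\pi)} = (-q;q^2)_\infty,\qquad \sum_{\pi\in\mathcal{P}} (-1)^{\mathcal{E}(\pi)} q^{\mathcal{O}(\pi)} = \frac{1}{(q^2;q^2)_\infty}.\]
   Context: A partition $\pi=(\lambda_1,\lambda_2,\dots)$ is a finite non-increasing sequence of positive integers; the empty sequence is the unique partition of $0$. $\mathcal{P}$ is the set of all partitions and $\mathcal{D}$ the set of partitions into distinct parts. $\mathcal{O}(\pi)=\lambda_1+\lambda_3+\cdots$, $\mathcal{E}(\pi)=\lambda_2+\lambda_4+\cdots$. $(a;q)_\infty=\prod_{i\ge0}(1-aq^i)$. *)

(* Defs.v *)
From HB Require Import structures.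
From mathcomp Require Import all_boot all_order all_algebra.
From mathcomp Require Import boolp classical_sets cardinality fsbigop.

Set Implicit Arguments.
Unset Strict Implicit.
Unset Printing Implicit Defensive.

Import GRing.Theory.

Local Open Scope classical_set_scope.
Local Open Scope ring_scope.

Record fps (R : Type) := Fps { fcoef : nat -> R }.

Lemma fpsP (R : Type) (F G : fps R) : fcoef F =1 fcoef G <-> F = G.
Proof. by case: F G => [f] [g]; split=> [/= /funext ->|[->]]. Qed.

HB.instance Definition _ (R : Type) := gen_eqMixin (fps R).
HB.instance Definition _ (R : Type) := gen_choiceMixin (fps R).

Definition fps_zero (R : nzRingType) : fps R := Fps (fun _ => 0).
Definition fps_opp (R : nzRingType) (F : fps R) : fps R :=
  Fps (fun n => - fcoef F n).
Definition fps_add (R : nzRingType) (F G : fps R) : fps R :=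
  Fps (fun n => fcoef F n + fcoef G n).

Lemma fps_addA (R : nzRingType) : associative (@fps_add R).
Proof. by move=> F G H; apply/fpsP => n /=; rewrite addrA. Qed.
Lemma fps_addC (R : nzRingType) : commutative (@fps_add R).
Proof. by move=> F G; apply/fpsP => n /=; rewrite addrC. Qed.
Lemma fps_add0 (R : nzRingType) : left_id (fps_zero R) (@fps_add R).
Proof. by move=> F; apply/fpsP => n /=; rewrite add0r. Qed.
Lemma fps_addN (R : nzRingType) :
  left_inverse (fps_zero R) (@fps_opp R) (@fps_add R).
Proof. by move=> F; apply/fpsP => n /=; rewrite addNr. Qed.

HB.instance Definition _ (R : nzRingType) := GRing.isZmodule.Build (fps R)
  (@fps_addA R) (@fps_addC R) (@fps_add0 R) (@fps_addN R).

Definition fps_one (R : comNzRingType) : fps R := Fps (fun n => (n == 0%N)%:R).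
Definition fps_mul (R : comNzRingType) (F G : fps R) : fps R :=
  Fps (fun n => \sum_(i < n.+1) fcoef F i * fcoef G (n - i)).

Definition fps_trunc (R : comNzRingType) (N : nat) (F : fps R) : {poly R} :=
  \poly_(i < N) fcoef F i.

Lemma fps_mul_trunc (R : comNzRingType) (N n : nat) (F G : fps R) :
  (n < N)%N -> fcoef (fps_mul F G) n = (fps_trunc N F * fps_trunc N G)`_n.
Proof.
move=> ltnN; rewrite coefM; apply: eq_bigr => i _.
by rewrite !coef_poly !(leq_ltn_trans _ ltnN) ?leq_subr -1?ltnS.
Qed.

Lemma fps_mulA (R : comNzRingType) : associative (@fps_mul R).
Proof.
move=> F G H; apply/fpsP => n.
have trM A B i : (i <= n)%N ->
    (fps_trunc n.+1 (fps_mul A B))`_i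
    = (fps_trunc n.+1 A * fps_trunc n.+1 B)`_i.
  by move=> lein; rewrite coef_poly ltnS lein (@fps_mul_trunc _ n.+1).
rewrite !(@fps_mul_trunc _ n.+1) //.
transitivity (fps_trunc n.+1 F * (fps_trunc n.+1 G * fps_trunc n.+1 H))`_n.
  by rewrite !coefM; apply: eq_bigr => i _; rewrite trM ?leq_subr.
rewrite mulrA !coefM; apply: eq_bigr => i _; rewrite trM // -ltnS.
exact: ltn_ord.
Qed.

Lemma fps_mulC (R : comNzRingType) : commutative (@fps_mul R).
Proof.
by move=> F G; apply/fpsP => n; rewrite !(@fps_mul_trunc _ n.+1) // mulrC.
Qed.

Lemma fps_mul1 (R : comNzRingType) : left_id (fps_one R) (@fps_mul R).
Proof.
move=> F; apply/fpsP => n /=; rewrite big_ord_recl /= mul1r subn0 big1 ?addr0 //.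
by move=> i _; rewrite mul0r.
Qed.

Lemma fps_mulDl (R : comNzRingType) :
  left_distributive (@fps_mul R) (@fps_add R).
Proof.
move=> F G H; apply/fpsP => n /=; rewrite -big_split /=.
by apply: eq_bigr => i _; rewrite mulrDl.
Qed.

Lemma fps_one_neq0 (R : comNzRingType) : fps_one R != 0.
Proof.
apply/eqP => /fpsP /(_ 0%N) /= /eqP; exact/negP/oner_neq0.
Qed.

HB.instance Definition _ (R : comNzRingType) :=
  GRing.Zmodule_isComNzRing.Build (fps R)
    (@fps_mulA R) (@fps_mulC R) (@fps_mul1 R) (@fps_mulDl R)
    (@fps_one_neq0 R).

Lemma fcoefD (R : comNzRingType) (F G : fps R) n :
  fcoef (F + G) n = fcoef F n + fcoef G n.
Proof. by []. Qed.

Lemma fcoefN (R : comNzRingType) (F : fps R) n : fcoef (- F) n = - fcoef F n.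
Proof. by []. Qed.

Lemma fcoef1 (R : comNzRingType) n : fcoef (1 : fps R) n = (n == 0%N)%:R.
Proof. by []. Qed.

Lemma fcoefM (R : comNzRingType) (F G : fps R) n :
  fcoef (F * G) n = \sum_(i < n.+1) fcoef F i * fcoef G (n - i).
Proof. by []. Qed.

Fixpoint fps_inv_seq (R : comUnitRingType) (F : fps R) (n : nat) : seq R :=
  if n is m.+1 then
    let s := fps_inv_seq F m in
    rcons s ((fcoef F 0)^-1
             * ((m == 0%N)%:R - \sum_(i < m) s`_i * fcoef F (m - i)))
  else [::].

Lemma size_fps_inv_seq (R : comUnitRingType) (F : fps R) n :
  size (fps_inv_seq F n) = n.
Proof. by elim: n => //= n IHn; rewrite size_rcons IHn. Qed.

Lemma nth_fps_inv_seq (R : comUnitRingType) (F : fps R) m n :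
  (n < m)%N -> (fps_inv_seq F m)`_n = (fps_inv_seq F n.+1)`_n.
Proof.
elim: m => // m IHm; rewrite ltnS leq_eqVlt => /predU1P[->//|ltnm].
by rewrite [LHS]/= nth_rcons size_fps_inv_seq ltnm IHm.
Qed.

Definition fps_unit (R : comUnitRingType) : {pred fps R} :=
  fun F => fcoef F 0 \is a GRing.unit.

Definition fps_inv (R : comUnitRingType) (F : fps R) : fps R :=
  if fps_unit F then Fps (fun n => (fps_inv_seq F n.+1)`_n) else F.

Lemma fps_mulV (R : comUnitRingType) :
  {in @fps_unit R, left_inverse 1 (@fps_inv R) *%R}.
Proof.
move=> F uF; have uF0 : fcoef F 0 \is a GRing.unit by [].
have -> : fps_inv F = Fps (fun n => (fps_inv_seq F n.+1)`_n).
  by rewrite /fps_inv /fps_unit uF0.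
apply/fpsP => n; rewrite fcoefM big_ord_recr /= subnn.
rewrite nth_rcons size_fps_inv_seq ltnn eqxx mulrAC mulVr // mul1r.
under eq_bigr => i _ do rewrite -[rcons _ _]/(fps_inv_seq F i.+1)
  -(nth_fps_inv_seq F (ltn_ord i)).
by rewrite addrC subrK.
Qed.

Lemma fps_unitPl (R : comUnitRingType) (F G : fps R) :
  G * F = 1 -> fps_unit F.
Proof.
move=> /fpsP /(_ 0%N); rewrite fcoefM big_ord1 => GF.
by apply/unitrP; exists (fcoef G 0); rewrite [_ * fcoef G 0]mulrC.
Qed.

Lemma fps_inv_out (R : comUnitRingType) :
  {in [predC @fps_unit R], @fps_inv R =1 id}.
Proof.
move=> F /negbTE uF; have {}uF : fps_unit F = false by [].
by rewrite /fps_inv uF.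
Qed.

HB.instance Definition _ (R : comUnitRingType) :=
  GRing.ComNzRing_hasMulInverse.Build (fps R)
    (@fps_mulV R) (@fps_unitPl R) (@fps_inv_out R).

Definition fpsX (R : comNzRingType) : fps R := Fps (fun n => (n == 1%N)%:R).

(* F is summable over D when each power of q receives a nonzero contribution
   from finitely many indices only; this is what makes fps_sum meaningful,
   as \sum_(i \in D) is 0 on infinite supports. *)
Definition fps_summable (R : nzRingType) (I : choiceType) (D : set I)
    (F : I -> fps R) : Prop :=
  forall n, finite_set [set i | D i /\ fcoef (F i) n <> 0].

Definition fps_sum (R : nzRingType) (I : choiceType) (D : set I)
    (F : I -> fps R) : fps R :=
  Fps (fun n => \sum_(i \in D) fcoef (F i) n).

(* Convergence for the q-adic topology (R being discrete). *)
Definition fps_cvg (R : Type) (u : nat -> fps R) (L : fps R) : Prop :=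
  forall n, exists N, forall m, (N <= m)%N -> fcoef (u m) n = fcoef L n.

Definition fps_lim (R : nzRingType) (u : nat -> fps R) : fps R :=
  xget 0 [set L | fps_cvg u L].

Lemma fps_cvg_lim (R : nzRingType) (u : nat -> fps R) (L : fps R) :
  fps_cvg u L -> fps_lim u = L.
Proof.
move=> uL; apply: xget_unique => // L' uL'; apply/fpsP => n.
have [N uN] := uL n; have [N' uN'] := uL' n.
by rewrite -(uN (maxn N N')) ?leq_maxl // -(uN' (maxn N N')) ?leq_maxr.
Qed.

Definition qpoch (R : comNzRingType) (a q : fps R) (n : nat) : fps R :=
  \prod_(i < n) (1 - a * q ^+ i).

(* (a; q)_oo *)
Definition qpoch_inf (R : comNzRingType) (a q : fps R) : fps R :=
  fps_lim (qpoch a q).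

Lemma fcoef_exp_small (R : comNzRingType) (q : fps R) i n :
  fcoef q 0 = 0 -> (n < i)%N -> fcoef (q ^+ i) n = 0.
Proof.
move=> q0; elim: i n => // i IHi n; rewrite ltnS => leni.
rewrite exprS fcoefM big1 // => -[[|j] ltj] _ /=; first by rewrite q0 mul0r.
by rewrite IHi ?mulr0 //; case: n leni ltj => // n leni _; rewrite subSS
  (leq_ltn_trans (leq_subr _ _)).
Qed.

Lemma qpoch_cvg (R : comNzRingType) (a q : fps R) :
  fcoef q 0 = 0 -> fps_cvg (qpoch a q) (qpoch_inf a q).
Proof.
move=> q0; pose L := Fps (fun n => fcoef (qpoch a q n.+1) n).
suff uL : fps_cvg (qpoch a q) L by rewrite /qpoch_inf (fps_cvg_lim uL).
move=> n; exists n.+1 => m /subnKC <-; elim: (m - n.+1)%N => [|k IHk].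
  by rewrite addn0.
rewrite addnS.
have -> : qpoch a q (n.+1 + k).+1
    = qpoch a q (n.+1 + k) - qpoch a q (n.+1 + k) * a * q ^+ (n.+1 + k).
  by rewrite {1}/qpoch big_ord_recr /= -/(qpoch a q _) mulrBr mulr1 mulrA.
rewrite fcoefD fcoefN IHk fcoefM big1 ?subr0 // => i _.
by rewrite fcoef_exp_small ?mulr0 // addSn ltnS (leq_trans (leq_subr _ _))
  ?leq_addr.
Qed.

Lemma qpoch_inf_unit (R : comUnitRingType) (a q : fps R) :
  fcoef a 0 = 0 -> fcoef q 0 = 0 -> qpoch_inf a q \is a GRing.unit.
Proof.
move=> a0 q0; have [N /(_ N (leqnn N)) E] := qpoch_cvg a q0 0.
have L0 : fcoef (qpoch_inf a q) 0 = 1.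
  rewrite -E /qpoch; elim: {E} N => [|N IHN]; first by rewrite big_ord0.
  rewrite big_ord_recr fcoefM big_ord1 IHN mul1r fcoefD fcoefN fcoefM.
  by rewrite big_ord1 a0 mul0r subr0.
by change (fcoef (qpoch_inf a q) 0 \is a GRing.unit); rewrite L0 unitr1.
Qed.

Definition partitions : set (seq nat) :=
  [set s | sorted geq s /\ all (leq 1) s].

Definition distinct_partitions : set (seq nat) :=
  [set s | partitions s /\ uniq s].

(* nth counts from 0, so the parts of odd rank lambda_1, lambda_3, ...
   are those at even positions. *)
Definition odd_sum (s : seq nat) : nat :=
  (\sum_(i < size s | ~~ odd i) nth 0 s i)%N.

Definition even_sum (s : seq nat) : nat :=
  (\sum_(i < size s | odd i) nth 0 s i)%N.

(* Main.v *)
Require Import Defs.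
From mathcomp Require Import all_boot all_order all_algebra.
From mathcomp Require Import boolp classical_sets cardinality fsbigop.
From mathcomp Require Import zify ring.

Set Implicit Arguments.
Unset Strict Implicit.
Unset Printing Implicit Defensive.

Import GRing.Theory.
Local Open Scope classical_set_scope.
Local Open Scope ring_scope.

(** Removing the largest part of a partition exchanges the parts of odd rank
    with those of even rank. So let [S_N x y] be the sum of [x^O(p) y^E(p)] over
    the partitions [p] with parts at most [N]; sorting them by whether [N + 1]
    is a part gives
      [S_(N+1) x y = S_N x y + x^(N+1) S_(N+1) y x],
    with [S_N y x] in place of [S_(N+1) y x] for distinct parts. For
    [{x, y} = {q, -1}] this is a linear recursion for the pair
    [(S_N q (-1), S_N (-1) q)], and two steps of it from an even [N] are
    explicit: at odd indices the second entry vanishes, at even ones the two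
    entries are equal to [(-q; q^2)_(N/2)] for distinct parts and to
    [1 / (q^2; q^2)_(N/2)] in general. Now let [N] tend to infinity. *)

Lemma signr_double (R : pzRingType) j : (-1) ^+ j.*2 = 1 :> R.
Proof. by rewrite -signr_odd odd_double. Qed.

Lemma signr_doubleS (R : pzRingType) j : (-1) ^+ j.*2.+1 = -1 :> R.
Proof. by rewrite exprS signr_double mulr1. Qed.

Section SummableFamilies.
Variables (R : comNzRingType) (I : choiceType).
Implicit Types (A B D : set I) (F : I -> fps R).

Lemma fps_summableS A B F : A `<=` B -> fps_summable B F -> fps_summable A F.
Proof. by move=> AB BF n; apply: sub_finite_set (BF n) => i [/AB]. Qed.

Lemma fcoef_fps_sum D F n (s : seq I) :
    uniq s -> [set` s] `<=` D ->
    (forall i, D i -> i \notin s -> fcoef (F i) n = 0) ->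
  fcoef (fps_sum D F) n = \sum_(i <- s) fcoef (F i) n.
Proof.
move=> s_uniq sD F0; rewrite fsbig_seq //; symmetry.
by apply: fsbig_widen => // i [Di /negP]; exact: F0.
Qed.

Lemma fps_summable_seq D F n : fps_summable D F ->
  exists s : seq I, [/\ uniq s, [set` s] `<=` D &
    forall i k, D i -> i \notin s -> (k <= n)%N -> fcoef (F i) k = 0].
Proof.
move=> DF; pose S := \bigcup_(k in `I_n.+1) [set i | D i /\ fcoef (F i) k <> 0].
have /finite_seqP[s Ss] : finite_set S.
  by apply: bigcup_finite => [|k _]; [exact: finite_II|exact: DF].
have mem_s i : (i \in undup s) <-> S i by rewrite mem_undup Ss.
exists (undup s); split=> [|i /mem_s[k _ []] //|i k Di s'i le_kn].
  exact: undup_uniq.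
by apply: contraNeq s'i => /eqP Fik; apply/mem_s; exists k.
Qed.

Lemma fps_sum_set1 F i : fps_sum [set i] F = F i.
Proof. by apply/fpsP => n /=; rewrite fsbig_set1. Qed.

Lemma fps_sum_setU A B F :
    fps_summable A F -> fps_summable B F -> A `&` B = set0 ->
  fps_sum (A `|` B) F = fps_sum A F + fps_sum B F.
Proof.
move=> AF BF AB0; apply/fpsP => n.
have [s [s_uniq sA F0s]] := fps_summable_seq n AF.
have [t [t_uniq tB F0t]] := fps_summable_seq n BF.
rewrite fcoefD (fcoef_fps_sum s_uniq sA); last by move=> i Ai s'i; rewrite F0s.
rewrite (fcoef_fps_sum t_uniq tB); last by move=> i Bi t'i; rewrite F0t.
rewrite -big_cat; apply: fcoef_fps_sum.
- rewrite cat_uniq s_uniq t_uniq andbT; apply/hasPn => i /tB Bi.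
  by apply/negP => /sA Ai; have : (A `&` B) i by []; rewrite AB0.
- by move=> i /=; rewrite mem_cat => /orP[/sA|/tB]; [left|right].
- move=> i ABi; rewrite mem_cat negb_or => /andP[s'i t'i].
  by case: ABi => ?; [exact: F0s|exact: F0t].
Qed.

Lemma fps_sum_mull D F (c : fps R) : fps_summable D F ->
  fps_sum D (fun i => c * F i) = c * fps_sum D F.
Proof.
move=> DF; apply/fpsP => n.
have [s [s_uniq sD F0]] := fps_summable_seq n DF.
rewrite (fcoef_fps_sum s_uniq sD) => [|i Di s'i]; last first.
  by rewrite fcoefM big1 // => k _; rewrite F0 ?mulr0 ?leq_subr.
under eq_bigr do rewrite fcoefM.
rewrite exchange_big fcoefM; apply: eq_bigr => k _.
rewrite -big_distrr (fcoef_fps_sum s_uniq sD) // => i Di s'i.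
by rewrite F0 ?leq_subr.
Qed.

Lemma fps_cvg_sum D (D_ : nat -> set I) F :
    (forall m, D_ m `<=` D) ->
    (forall n, exists N, forall m, (N <= m)%N ->
       [set i | D i /\ fcoef (F i) n <> 0] `<=` D_ m) ->
  fps_cvg (fun m => fps_sum (D_ m) F) (fps_sum D F).
Proof.
move=> D_D D_supp n; have [N suppN] := D_supp n; exists N => m /suppN supp_m.
apply: fsbig_widen => [|i [Di D_'i]]; first exact: D_D.
by apply: contra_notP D_'i => Fin; exact: supp_m.
Qed.

End SummableFamilies.

Lemma fps_sum_image (R : comNzRingType) (I J : choiceType) (h : I -> J)
    (D : set I) (F : J -> fps R) : injective h ->
  fps_sum (h @` D) F = fps_sum D (F \o h).
Proof.
by move=> h_inj; apply/fpsP => n; apply: fsbig_image => i j _ _ /h_inj.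
Qed.

Section Convergence.
Variable R : comNzRingType.
Implicit Types (u v : nat -> fps R) (L M : fps R).

Lemma fps_cvg_unique u L M : fps_cvg u L -> fps_cvg u M -> L = M.
Proof. by move=> /fps_cvg_lim <- /fps_cvg_lim <-. Qed.

Lemma fps_cvg_coef_le u L n : fps_cvg u L ->
  exists N, forall m k, (N <= m)%N -> (k <= n)%N -> fcoef (u m) k = fcoef L k.
Proof.
move=> uL; elim: n => [|n [N uN]].
  by have [N uN] := uL 0; exists N => m k /uN uNm; rewrite leqn0 => /eqP->.
have [N' uN'] := uL n.+1; exists (maxn N N') => m k.
rewrite geq_max [(k <= _)%N]leq_eqVlt => /andP[Nm N'm] /predU1P[->|].
  exact: uN'.
exact: uN.
Qed.

Lemma fps_cvgM u v L M :
  fps_cvg u L -> fps_cvg v M -> fps_cvg (fun m => u m * v m) (L * M).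
Proof.
move=> uL vM n; have [N uN] := fps_cvg_coef_le n uL.
have [N' vN'] := fps_cvg_coef_le n vM; exists (maxn N N') => m.
rewrite geq_max => /andP[Nm N'm]; rewrite !fcoefM.
by apply: eq_bigr => i _; rewrite uN ?vN' ?leq_subr // -ltnS.
Qed.

End Convergence.

Lemma fcoef_mul_exp_neq0 (R : comNzRingType) (x y : fps R) i n :
  fcoef x 0 = 0 -> fcoef (y * x ^+ i) n <> 0 -> (i <= n)%N.
Proof.
move=> x0; apply: contra_notT; rewrite -ltnNge fcoefM => lt_ni.
by rewrite big1 // => k _;
  rewrite fcoef_exp_small ?mulr0 // (leq_ltn_trans (leq_subr _ _)).
Qed.

Lemma lreg_fps_add1 (R : comNzRingType) (x : fps R) :
  fcoef x 0 = 0 -> GRing.lreg (1 + x).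
Proof.
move=> x0; apply: mulrI0_lreg => F; rewrite mulrDl mul1r => /fpsP xF.
apply/fpsP; elim/ltn_ind => n IHn; have := xF n.
rewrite fcoefD fcoefM big_ord_recl x0 mul0r add0r big1 ?addr0 // => i _.
by rewrite IHn ?mulr0 //= /bump; have := ltn_ord i; lia.
Qed.

Lemma odd_even_sum_nil : (odd_sum [::] = 0%N) * (even_sum [::] = 0%N).
Proof. by rewrite /odd_sum /even_sum !big_ord0. Qed.

Lemma odd_even_sum_cons m p :
  (odd_sum (m :: p) = (m + even_sum p)%N) * (even_sum (m :: p) = odd_sum p).
Proof.
rewrite /odd_sum /even_sum !(big_mkcond (fun i => ~~ odd _)).
rewrite !(big_mkcond (fun i => odd _)) !big_ord_recl /= add0n.
by split=> //; congr (_ + _)%N; apply: eq_bigr => i _; rewrite /= negbK.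
Qed.

Lemma odd_sumD_even_sum p : (odd_sum p + even_sum p)%N = sumn p.
Proof.
elim: p => [|m p /= <-]; first by rewrite !odd_even_sum_nil.
by rewrite !odd_even_sum_cons addnAC addnA.
Qed.

Lemma partitions_cons m p :
  partitions (m :: p) <-> [/\ (0 < m)%N, (head 0 p <= m)%N & partitions p].
Proof.
rewrite /partitions; case: p => [|k p] /=.
  by split=> [[_ /andP[]]|[-> _ _]].
by split=> [[/andP[-> ->] /and3P[-> -> ->]]|[-> -> [-> /andP[-> ->]]]].
Qed.

Lemma distinct_partitions_cons m p :
  distinct_partitions (m :: p) <-> (head 0 p < m)%N /\ distinct_partitions p.
Proof.
have distinctE s : distinct_partitions s <-> sorted gtn s && all (leq 1) s.
  rewrite gtn_sorted_uniq_geq; split=> [[[-> ->] ->] //|].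
  by move=> /andP[/andP[us ss] ps].
rewrite !distinctE; case: p => [|k p] /=.
  by rewrite !andbT; split=> // -[].
case: (ltnP k m) => [lt_km|_] /=; last by split=> // -[].
by rewrite (leq_ltn_trans _ lt_km) //; split=> [|[]].
Qed.

Lemma odd_sum_bounds p : partitions p ->
  (even_sum p <= odd_sum p <= head 0 p + even_sum p)%N.
Proof.
elim: p => [|m p IHp]; first by rewrite !odd_even_sum_nil.
by move=> /partitions_cons[_ le_pm /IHp]; rewrite !odd_even_sum_cons /=; lia.
Qed.

Lemma head_le_odd_sum p : (head 0 p <= odd_sum p)%N.
Proof. by case: p => // m p; rewrite odd_even_sum_cons leq_addr. Qed.

Lemma finite_sumn_lt n :
  finite_set [set p : seq nat | all (leq 1) p /\ (sumn p < n)%N].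
Proof.
elim: n => [|n IHn]; first by apply: sub_finite_set (finite_set0 _) => p [].
apply: sub_finite_set (_ : finite_set ([set [::]] `|` _)); last first.
  rewrite finite_setU; split; first exact: finite_set1.
  exact: finite_image2 cons (finite_II n.+1) IHn.
move=> [|m p] [] /=; first by left.
case/andP=> m_gt0 p_pos lt_mpn; right.
by exists m => /=; [lia|exists p => //; split=> //; lia].
Qed.

Lemma finite_partitions_odd_sum_le n :
  finite_set [set p | partitions p /\ (odd_sum p <= n)%N].
Proof.
apply: sub_finite_set (finite_sumn_lt (n + n).+1) => p [pP le_pn].
split; first by case: pP.
by have := odd_sum_bounds pP; rewrite -odd_sumD_even_sum; lia.
Qed.

Definition parts_le (D : set (seq nat)) (N : nat) : set (seq nat) :=
  D `&` [set p | (head 0 p <= N)%N].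

Lemma parts_le0 (D : set (seq nat)) :
  D `<=` partitions -> D [::] -> parts_le D 0 = [set [::]].
Proof.
move=> D_part D0; apply/seteqP; split=> [[|m p] [Dp /=]|_ ->//].
  by [].
by have /partitions_cons[m_gt0 _ _] := D_part _ Dp; lia.
Qed.

Lemma parts_leS (D E : set (seq nat)) N :
    (forall p, D (N.+1 :: p) <-> E p) ->
  parts_le D N.+1 = parts_le D N `|` cons N.+1 @` E.
Proof.
move=> DE; apply/seteqP; split=> [[|m p] [Dp /= le_mN]|p].
- by left.
- move: le_mN; rewrite leq_eqVlt => /predU1P[m_eq|]; last by left.
  by right; exists p; [apply/DE; rewrite -m_eq|rewrite m_eq].
- by case=> [[Dp le_pN]|[p' Ep' <-]]; split=> //=; [exact: leqW|exact/DE].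
Qed.

Definition rank_weight (R : comNzRingType) (x y : fps R) (p : seq nat) :
  fps R :=
  y ^+ even_sum p * x ^+ odd_sum p.

Section RankWeight.
Variables (R : comNzRingType) (x y : fps R).

Lemma rank_weight_nil : rank_weight x y [::] = 1.
Proof. by rewrite /rank_weight !odd_even_sum_nil mulr1. Qed.

Lemma rank_weight_cons m p :
  rank_weight x y (m :: p) = x ^+ m * rank_weight y x p.
Proof. by rewrite /rank_weight !odd_even_sum_cons exprD; ring. Qed.

Lemma rank_weight_summable :
  fcoef x 0 = 0 -> fps_summable partitions (rank_weight x y).
Proof.
move=> x0 n; apply: sub_finite_set (finite_partitions_odd_sum_le n) => p.
by move=> [pP /(fcoef_mul_exp_neq0 x0)].
Qed.

End RankWeight.

Lemma rank_weight_summable_parts_le (R : comNzRingType) (x y : fps R) N :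
    fcoef x 0 = 0 \/ fcoef y 0 = 0 ->
  fps_summable (parts_le partitions N) (rank_weight x y).
Proof.
case=> [x0|y0].
  by apply: fps_summableS (rank_weight_summable y x0) => p [].
move=> n; apply: sub_finite_set (finite_partitions_odd_sum_le (N + n)).
move=> p [[pP le_pN]].
rewrite /rank_weight mulrC => /(fcoef_mul_exp_neq0 y0) le_En; split=> //.
by have := odd_sum_bounds pP; move: le_pN => /=; lia.
Qed.

Lemma rank_weight_sum_setU_cons (R : comNzRingType) (x y : fps R) m
    (A B : set (seq nat)) :
    A `<=` [set p | (head 0 p < m)%N] ->
    fps_summable (A `|` cons m @` B) (rank_weight x y) ->
    fps_summable B (rank_weight y x) ->
  fps_sum (A `|` cons m @` B) (rank_weight x y) =
  fps_sum A (rank_weight x y) + x ^+ m * fps_sum B (rank_weight y x).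
Proof.
move=> A_lt sumAB sumB; rewrite fps_sum_setU.
- rewrite fps_sum_image => [|p p' [] //]; rewrite -fps_sum_mull //.
  by congr (_ + fps_sum _ _); apply/funext => p; exact: rank_weight_cons.
- by apply: fps_summableS sumAB => p; left.
- by apply: fps_summableS sumAB => p; right.
- by apply/seteqP; split=> [_ [/[swap] [[p _ <-]] /A_lt /=]|//]; rewrite ltnn.
Qed.

Definition part_sum (R : comNzRingType) (D : set (seq nat)) (N : nat)
  (x y : fps R) : fps R := fps_sum (parts_le D N) (rank_weight x y).

Section PartSum.
Variables (R : comNzRingType) (D : set (seq nat)).
Hypothesis D_part : D `<=` partitions.

Lemma part_sum0 (x y : fps R) : D [::] -> part_sum D 0 x y = 1.
Proof.
by move=> D0; rewrite /part_sum parts_le0 // fps_sum_set1 rank_weight_nil.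
Qed.

Lemma part_sumS N M (x y : fps R) :
    fcoef x 0 = 0 \/ fcoef y 0 = 0 ->
    (forall p, D (N.+1 :: p) <-> parts_le D M p) ->
  part_sum D N.+1 x y = part_sum D N x y + x ^+ N.+1 * part_sum D M y x.
Proof.
have D_le K : parts_le D K `<=` parts_le partitions K.
  by move=> p [/D_part].
move=> xy0 consD; have yx0 : fcoef y 0 = 0 \/ fcoef x 0 = 0 by apply/or_comm.
rewrite /part_sum (parts_leS consD) rank_weight_sum_setU_cons //.
- by move=> p [].
- rewrite -(parts_leS consD).
  exact: fps_summableS (D_le _) (rank_weight_summable_parts_le _ xy0).
- exact: fps_summableS (D_le _) (rank_weight_summable_parts_le _ yx0).
Qed.

Lemma part_sum_cvg (x y : fps R) (f : nat -> nat) :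
    fcoef x 0 = 0 -> (forall n, (n <= f n)%N) ->
  fps_cvg (fun j => part_sum D (f j) x y) (fps_sum D (rank_weight x y)).
Proof.
move=> x0 f_ge; apply: fps_cvg_sum => [j p [] //|n]; exists n => j le_nj p.
move=> [Dp /(fcoef_mul_exp_neq0 x0) le_pn]; split=> //=.
rewrite (leq_trans (head_le_odd_sum p)) // (leq_trans le_pn) //.
exact: leq_trans (f_ge j).
Qed.

End PartSum.

Lemma part_sum_distinctS (R : comNzRingType) N (x y : fps R) :
    fcoef x 0 = 0 \/ fcoef y 0 = 0 ->
  part_sum distinct_partitions N.+1 x y =
  part_sum distinct_partitions N x y
  + x ^+ N.+1 * part_sum distinct_partitions N y x.
Proof.
move=> xy0; apply: part_sumS xy0 _ => [p []|p] //.
by rewrite distinct_partitions_cons; split=> -[].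
Qed.

Lemma part_sum_partitionsS (R : comNzRingType) N (x y : fps R) :
    fcoef x 0 = 0 \/ fcoef y 0 = 0 ->
  part_sum partitions N.+1 x y =
  part_sum partitions N x y + x ^+ N.+1 * part_sum partitions N.+1 y x.
Proof.
move=> xy0; apply: part_sumS xy0 _ => // p.
by rewrite partitions_cons; split=> [[]|[]].
Qed.

Lemma part_sum_distinct_double (R : comNzRingType) (q : fps R) j :
    fcoef q 0 = 0 ->
  part_sum distinct_partitions j.*2 q (-1) = qpoch (- q) (q ^+ 2) j /\
  part_sum distinct_partitions j.*2 (-1) q = qpoch (- q) (q ^+ 2) j.
Proof.
move=> q0; elim: j => [|j [IHsum IHswap]].
  by rewrite !part_sum0 /qpoch ?big_ord0 // => p [].
have sumS N := part_sum_distinctS N (or_introl q0 : _ \/ fcoef (-1) 0 = 0).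
have swap_sumS N := part_sum_distinctS N (or_intror q0 : fcoef (-1) 0 = 0 \/ _).
have qpochS : qpoch (- q) (q ^+ 2) j.+1 =
    qpoch (- q) (q ^+ 2) j * (1 + q ^+ j.*2.+1).
  by rewrite /qpoch big_ord_recr /= mulNr opprK -exprM mul2n -exprS.
have sum_odd : part_sum distinct_partitions j.*2.+1 q (-1)
    = qpoch (- q) (q ^+ 2) j.+1.
  by rewrite sumS IHsum IHswap qpochS; ring.
have swap_sum_odd : part_sum distinct_partitions j.*2.+1 (-1) q = 0.
  by rewrite swap_sumS IHsum IHswap signr_doubleS; ring.
rewrite doubleS (sumS j.*2.+1) (swap_sumS j.*2.+1) sum_odd swap_sum_odd.
by rewrite -doubleS signr_double; split; ring.
Qed.

(* Stated without inverses, so that continuity of the product suffices to pass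
   to the limit. *)
Lemma part_sum_partitions_double (R : comNzRingType) (q : fps R) j :
    fcoef q 0 = 0 ->
  part_sum partitions j.*2 q (-1) * qpoch (q ^+ 2) (q ^+ 2) j = 1 /\
  part_sum partitions j.*2 (-1) q = part_sum partitions j.*2 q (-1).
Proof.
move=> q0; elim: j => [|j [IHsum IHswap]].
  by rewrite !part_sum0 /qpoch ?big_ord0 ?mulr1.
have sumS N := part_sum_partitionsS N (or_introl q0 : _ \/ fcoef (-1) 0 = 0).
have swap_sumS N :=
  part_sum_partitionsS N (or_intror q0 : fcoef (-1) 0 = 0 \/ _).
have qpochS : qpoch (q ^+ 2) (q ^+ 2) j.+1 =
    qpoch (q ^+ 2) (q ^+ 2) j * (1 - q ^+ j.*2.+2).
  by rewrite /qpoch big_ord_recr /= -exprS -exprM mul2n doubleS.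
have swap_sum_odd : part_sum partitions j.*2.+1 (-1) q = 0.
  have lreg_odd : GRing.lreg (1 + q ^+ j.*2.+1).
    by apply: lreg_fps_add1; rewrite fcoef_exp_small.
  apply: lreg_odd; rewrite mulr0 mulrDl mul1r.
  by rewrite {1}swap_sumS IHswap signr_doubleS sumS; ring.
have sum_odd :
    part_sum partitions j.*2.+1 q (-1) = part_sum partitions j.*2 q (-1).
  by rewrite sumS swap_sum_odd mulr0 addr0.
have swap_sum_even :
    part_sum partitions j.+1.*2 (-1) q = part_sum partitions j.+1.*2 q (-1).
  by rewrite {1}doubleS swap_sumS swap_sum_odd -doubleS signr_double; ring.
have sum_even : part_sum partitions j.+1.*2 q (-1) * (1 - q ^+ j.*2.+2) =
    part_sum partitions j.*2.+1 q (-1).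
  by rewrite mulrBr mulr1 -{2}swap_sum_even {1}doubleS sumS doubleS; ring.
by split=> //; rewrite qpochS mulrCA sum_even sum_odd mulrC.
Qed.

Lemma fps_sum_distinct_partitions (R : comNzRingType) (q : fps R) :
    fcoef q 0 = 0 ->
  fps_sum distinct_partitions (rank_weight q (-1)) = qpoch_inf (- q) (q ^+ 2).
Proof.
move=> q0; have q20 : fcoef (q ^+ 2) 0 = 0 by rewrite fcoef_exp_small.
apply: fps_cvg_unique (qpoch_cvg (- q) q20).
rewrite (_ : qpoch _ _ = fun j => part_sum distinct_partitions j.*2 q (-1)).
  by apply: part_sum_cvg => // n; rewrite -addnn leq_addr.
by apply/funext => j; have [] := part_sum_distinct_double j q0.
Qed.

Lemma fps_sum_partitions (R : comUnitRingType) (q : fps R) :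
    fcoef q 0 = 0 ->
  fps_sum partitions (rank_weight q (-1)) = 1 / qpoch_inf (q ^+ 2) (q ^+ 2).
Proof.
move=> q0; have q20 : fcoef (q ^+ 2) 0 = 0 by rewrite fcoef_exp_small.
have sum_cvg : fps_cvg (fun j => part_sum partitions j.*2 q (-1))
    (fps_sum partitions (rank_weight q (-1))).
  by apply: part_sum_cvg => // n; rewrite -addnn leq_addr.
have sum_mul_qpoch_inf : fps_sum partitions (rank_weight q (-1))
    * qpoch_inf (q ^+ 2) (q ^+ 2) = 1.
  apply: fps_cvg_unique (fps_cvgM sum_cvg (qpoch_cvg _ q20)) _ => n.
  by exists 0%N => j _; have [-> _] := part_sum_partitions_double j q0.
have inf_unit := qpoch_inf_unit q20 q20.
by apply: (mulIr inf_unit); rewrite sum_mul_qpoch_inf divrK.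
Qed.

Theorem theorem4p1 :
  let q : fps int := fpsX int in
  let term (p : seq nat) : fps int := (-1) ^+ even_sum p * q ^+ odd_sum p in
  (fps_summable distinct_partitions term
   /\ fps_sum distinct_partitions term = qpoch_inf (- q) (q ^+ 2))
  /\ (fps_summable partitions term
      /\ fps_sum partitions term = 1 / qpoch_inf (q ^+ 2) (q ^+ 2)).
Proof.
move=> q term; have q0 : fcoef q 0 = 0 by [].
have term_summable : fps_summable partitions term.
  exact: rank_weight_summable.
split; split=> //.
- by apply: fps_summableS term_summable => p [].
- exact: fps_sum_distinct_partitions.
- exact: fps_sum_partitions.
Qed.
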